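(* Let $M\in\mathbb{R}^{m\times n}$ with $m\ge n$, let $1\le k\le r\le m$, $k\le n$, $k<m$, and suppose $\operatorname{rank}(M)\ge k$ (so that volume sampling is well defined). Let $\sigma_1\ge\sigma_2\ge\dots\ge\sigma_n\ge 0$ be the singular values of $M$. Let $(I,J)\in\mathcal{S}_r(m)\times\mathcal{S}_k(n)$ be drawn by volume sampling and let $M_{\mathrm{CUR}}=M_{:,J}M_{I,J}^+M_{I,:}$. Then $$\mathbb{E}\left(\|M-M_{\mathrm{CUR}}\|_F^2\right)\le\left(\frac{m-r}{m-k}(k+1)^2+\frac{r-k}{m-k}(k+1)\right)\sum_{i=k+1}^n\sigma_i^2 .$$
   Context: $\mathcal{S}_q(N)$ denotes the set of all $q$-element subsets of $\{1,\dots,N\}$. For $I\in\mathcal{S}_r(m)$ and $J\in\mathcal{S}_k(n)$, $M_{I,J}$ is the submatrix of $M$ with rows indexed by $I$ and columns indexed by $J$; $M_{:,J}$ consists of the columns of $M$ indexed by $J$ and $M_{I,:}$ of the rows indexed by $I$. $A^+$ is the Moore–Penrose pseudoinverse and $\|\cdot\|_F$ the Frobenius norm. Volume sampling is the probability distribution on $\mathcal{S}_r(m)\times\mathcal{S}_k(n)$ given by $$p(I,J)=\zeta^{-1}\det(M_{I,J}^{T}M_{I,J}),\qquad \zeta=\sum_{(I,J)\in\mathcal{S}_r(m)\times\mathcal{S}_k(n)}\det(M_{I,J}^{T}M_{I,J}),$$ and $\mathbb{E}$ is the expectation with respect to $p$. *)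

(* Defs.v *)
From HB Require Import structures.
From mathcomp Require Import all_boot all_order all_algebra.
From mathcomp Require Import boolp classical_sets reals.

Set Implicit Arguments.
Unset Strict Implicit.
Unset Printing Implicit Defensive.

Import Order.TTheory GRing.Theory Num.Theory.

Local Open Scope ring_scope.

(* The set S_q(N); {1, ..., N} is encoded as 'I_N = {0, ..., N-1}. *)
Definition qsubsets (q N : nat) : {set {set 'I_N}} :=
  [set A : {set 'I_N} | #|A| == q].

(* Extracted rows and columns keep their increasing order, since enum_val lists
   the elements of I and J increasingly. *)
Definition rows (T : Type) m n (I : {set 'I_m}) (M : 'M[T]_(m, n)) :
  'M[T]_(#|I|, n) := rowsub (fun i : 'I_#|I| => enum_val i) M.

Definition cols (T : Type) m n (J : {set 'I_n}) (M : 'M[T]_(m, n)) :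
  'M[T]_(m, #|J|) := colsub (fun j : 'I_#|J| => enum_val j) M.

Definition submx_IJ (T : Type) m n (I : {set 'I_m}) (J : {set 'I_n})
  (M : 'M[T]_(m, n)) : 'M[T]_(#|I|, #|J|) :=
  mxsub (fun i : 'I_#|I| => enum_val i) (fun j : 'I_#|J| => enum_val j) M.

(* The four Penrose conditions. *)
Definition is_pinv (R : realType) m n (A : 'M[R]_(m, n)) (X : 'M[R]_(n, m)) :=
  [/\ A *m X *m A = A, X *m A *m X = X,
      (A *m X)^T = A *m X & (X *m A)^T = X *m A].

(* The default value 0 of xget is never used: see pinvP and pinv_uniq. *)
Definition pinv (R : realType) m n (A : 'M[R]_(m, n)) : 'M[R]_(n, m) :=
  xget 0 (is_pinv A).

Definition frobenius_norm (R : realType) m n (A : 'M[R]_(m, n)) : R :=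
  Num.sqrt (\sum_i \sum_j A i j ^+ 2).

(* s 0 >= s 1 >= ... >= s (n-1) >= 0 are the singular values of M, i.e. the
   square roots of the eigenvalues of M^T M, counted with multiplicity. *)
Definition singular_values (R : realType) m n (M : 'M[R]_(m, n))
    (s : 'I_n -> R) : Prop :=
  [/\ forall i, 0 <= s i,
      forall i j : 'I_n, (i <= j)%N -> s j <= s i
    & char_poly (M^T *m M) = \prod_(i < n) ('X - (s i ^+ 2)%:P)].

Section VolumeSampling.
Context {R : realType} {m n : nat}.
Variables (r k : nat) (M : 'M[R]_(m, n)).

Definition vol2 (I : {set 'I_m}) (J : {set 'I_n}) : R :=
  \det ((submx_IJ I J M)^T *m submx_IJ I J M).

Definition vs_zeta : R :=
  \sum_(I in qsubsets r m) \sum_(J in qsubsets k n) vol2 I J.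

Definition vs_prob (I : {set 'I_m}) (J : {set 'I_n}) : R :=
  vs_zeta^-1 * vol2 I J.

Definition vs_expectation (f : {set 'I_m} -> {set 'I_n} -> R) : R :=
  \sum_(I in qsubsets r m) \sum_(J in qsubsets k n) vs_prob I J * f I J.

End VolumeSampling.

Definition CUR (R : realType) m n (M : 'M[R]_(m, n))
    (I : {set 'I_m}) (J : {set 'I_n}) : 'M[R]_(m, n) :=
  cols J M *m pinv (submx_IJ I J M) *m rows I M.

Lemma mul_tr_eq0 (R : realType) m n (A : 'M[R]_(m, n)) :
  A *m A^T = 0 -> A = 0.
Proof.
move=> A0; apply/matrixP=> i j; rewrite mxE.
have /eqP := congr1 (fun B : 'M[R]_m => B i i) A0; rewrite !mxE psumr_eq0.
  by move=> /allP /(_ j (mem_index_enum _)) /=; rewrite mxE mulf_eq0 orbb => /eqP.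
by move=> l _; rewrite mxE -expr2 sqr_ge0.
Qed.

Lemma gram_unitmx (R : realType) m n (A : 'M[R]_(m, n)) :
  row_free A -> A *m A^T \in unitmx.
Proof.
move=> fA; rewrite -row_free_unit; apply/row_freeP; move: fA => /row_freeP[B AB].
apply/row_freeP; rewrite -kermx_eq0; set K := kermx _.
have KG : K *m (A *m A^T) = 0 by exact: mulmx_ker.
have KA : K *m A = 0.
  by apply: mul_tr_eq0; rewrite trmx_mul mulmxA -(mulmxA K) KG mul0mx.
by apply/eqP; rewrite -(mulmx1 K) -AB mulmxA KA mul0mx.
Qed.

Lemma pinvP (R : realType) m n (A : 'M[R]_(m, n)) : is_pinv A (pinv A).
Proof.
apply: (@xgetPex _ _ (is_pinv A)).
move: (mulmx_base A) (row_base_free A) (col_base_full A).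
move: (col_base A) (row_base A); move: (\rank A) => p C F AE fF fC.
have uF : F *m F^T \in unitmx by exact: gram_unitmx.
have uC : C^T *m C \in unitmx.
  by rewrite -{2}(trmxK C) gram_unitmx // /row_free mxrank_tr.
exists (F^T *m invmx (F *m F^T) *m (invmx (C^T *m C) *m C^T)).
set X := _ *m _.
have AX : A *m X = C *m invmx (C^T *m C) *m C^T.
  rewrite -[in LHS]AE /X -!mulmxA; congr (_ *m _).
  by rewrite (mulmxA F) mulKVmx.
have XA : X *m A = F^T *m invmx (F *m F^T) *m F.
  rewrite -[in LHS]AE /X -!mulmxA; do 2 congr (_ *m _).
  by rewrite (mulmxA C^T) mulKmx.
split.
- by rewrite AX -AE -!mulmxA (mulmxA C^T) mulKmx.
- by rewrite XA {1}/X -!mulmxA (mulmxA F) mulKVmx // /X -!mulmxA.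
- by rewrite AX !trmx_mul trmxK trmx_inv trmx_mul trmxK mulmxA.
- by rewrite XA !trmx_mul trmxK trmx_inv trmx_mul trmxK mulmxA.
Qed.

Lemma pinv_uniq (R : realType) m n (A : 'M[R]_(m, n)) (X : 'M[R]_(n, m)) :
  is_pinv A X -> X = pinv A.
Proof.
move=> [A1 X1 A2 X2]; have [B1 Y1 B2 Y2] := pinvP A; move: B1 Y1 B2 Y2.
set Y := pinv A => B1 Y1 B2 Y2.
have AXY : A *m X = A *m Y.
  by rewrite -A2 -[in LHS]B1 -mulmxA trmx_mul A2 B2 mulmxA A1.
have XAY : X *m A = Y *m A.
  by rewrite -X2 -[in LHS]B1 -(mulmxA A) mulmxA trmx_mul X2 Y2 -mulmxA (mulmxA A) A1.
by rewrite -X1 -mulmxA AXY mulmxA XAY.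
Qed.

(* Main.v *)
Require Import Defs.
From HB Require Import structures.
From mathcomp Require Import all_boot all_order all_algebra.
From mathcomp Require Import boolp classical_sets reals.
(* Re-imported so that setT, setP, subsetP mean those of finite sets. *)
From mathcomp Require Import fintype finset fingroup perm.
From mathcomp Require Import ring zify.

Set Implicit Arguments.
Unset Strict Implicit.
Unset Printing Implicit Defensive.

Import Order.TTheory GRing.Theory Num.Theory.

Local Open Scope ring_scope.

(** Everything is expressed through squared minors.  For row and column tuples
    f, g of length q write M_(f,g) for the minor matrix; tuples with a repeated
    entry give determinant zero, so a sum over tuples counts each set q! times.

    Fix I, J with G = A^T A invertible, where A = M_(I,J), and put V = det G.  In
    column j the residual of CUR is that of the least-squares fit, over the rows
    of I, of the column by those of J.  By the Schur complement
    ([det_bordered]), V times the sum over i in I of the squared residuals is the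
    Gram determinant of A augmented with column j ([det_gram_residual]), which
    Cauchy-Binet turns into squared minors of order k + 1 with rows in I.  For
    i outside I, V times the residual is the determinant of G bordered by the row
    M_(i,J) and the column A^T M_(I,j); Cauchy-Binet applied to the rows of G
    alone writes it as 1 / k! times the sum, over k-tuples h in I, of det A_h
    times the minor of M on the rows h, i and the columns J, j.  The sum of the
    det A_h ^ 2 being k! V, expanding a sum of squares (Cauchy-Schwarz) bounds
    k! V times the squared residual by the sum of the squares of those minors
    ([det_bordered_residual_le]).  Pairs (I, J) with V = 0 have probability 0.

    It remains to sum over I and J.  Each minor of order q is met once for every
    I of size r containing its rows, that is N_q = 'C(m - q, m - r) times, and
    N_k - N_(k+1) times when one further row must avoid I.  With T_q the sum of
    all squared minors over pairs of q-tuples, this gives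

      k!^2 zeta             = N_k T_k                              ([vs_zetaE])
      k!^2 sum of the bound = (N_(k+1) / (k + 1) + N_k - N_(k+1)) T_(k+1)
                                                         ([sum_error_bounds])

    and (m - k) N_(k+1) = (r - k) N_k produces the two weights of the statement.
    Finally T_q = q!^2 e_q(sigma^2), by Cauchy-Binet and because the sums of
    principal minors of M^T M are, up to sign, coefficients of its
    characteristic polynomial
    ([eq_char_poly_principal]), and e_(k+1) is at most e_k times the sum of the
    sigma_i^2 with i >= k, since any k + 1 indices include one that is at least
    k ([esym_tail_le]). *)

(** * Cauchy-Binet and bordered determinants *)

Section Determinants.
Variable R : comNzRingType.
Implicit Types p q s : nat.

(** Multilinearity of the determinant in its first q rows, each of which is a
    combination of rows of Y. *)
Lemma det_col_mx_mul p q s (X : 'M[R]_(q, p)) (Y : 'M[R]_(p, q + s))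
    (Z : 'M[R]_(s, q + s)) :
  \det (col_mx (X *m Y) Z) =
  \sum_(h : {ffun 'I_q -> 'I_p})
    (\prod_i X i (h i)) * \det (col_mx (rowsub h Y) Z).
Proof.
rewrite /determinant.
under [RHS]eq_bigr => h _ do rewrite big_distrr /=.
rewrite exchange_big /=; apply: eq_bigr => t _.
rewrite big_split_ord /=.
under [X in _ * (X * _)]eq_bigr => i _ do rewrite col_mxEu mxE.
rewrite bigA_distr_bigA /= big_distrl /= big_distrr /=.
apply: eq_bigr => h _; rewrite [in RHS]big_split_ord /= big_split /=.
under [X in _ = _ * (_ * (X * _))]eq_bigr => i _ do rewrite col_mxEu mxE.
under [X in _ = _ * (_ * (_ * X))]eq_bigr => i _ do rewrite col_mxEd.
under [X in _ * (_ * X) = _]eq_bigr => i _ do rewrite col_mxEd.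
by rewrite !mulrA; congr (_ * _ * _); rewrite mulrC.
Qed.

Lemma det_col_mx_rowsub_perm p q s (h : {ffun 'I_q -> 'I_p}) (t : 'S_q)
    (Y : 'M[R]_(p, q + s)) (Z : 'M[R]_(s, q + s)) :
  \det (col_mx (rowsub [ffun i => h (t i)] Y) Z)
  = (-1) ^+ t * \det (col_mx (rowsub h Y) Z).
Proof.
rewrite -det_perm -[X in X * _]mulr1 -[X in _ * X * _](det1 R s).
rewrite -(det_ublock _ 0) -det_mulmx; congr (\det _).
rewrite mul_block_col !mul0mx addr0 add0r mul1mx -row_permE.
by congr col_mx; apply/matrixP=> i j; rewrite !mxE ffunE.
Qed.

(** Averaging [det_col_mx_mul] over the permutations of the first q rows turns
    the product of entries of X into a minor of X.  The fixed rows Z are what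
    allows a bordered Gram matrix to be expanded without touching its border. *)
Theorem cauchy_binet_rows p q s (X : 'M[R]_(q, p)) (Y : 'M[R]_(p, q + s))
    (Z : 'M[R]_(s, q + s)) :
  q`!%:R * \det (col_mx (X *m Y) Z) =
  \sum_(h : {ffun 'I_q -> 'I_p})
    \det (colsub h X) * \det (col_mx (rowsub h Y) Z).
Proof.
rewrite det_col_mx_mul.
have perm_sum (t : 'S_q) : \sum_(h : {ffun 'I_q -> 'I_p})
    (\prod_i X i (h i)) * \det (col_mx (rowsub h Y) Z) =
  \sum_(h : {ffun 'I_q -> 'I_p})
    (-1) ^+ t * (\prod_i X i (h (t i))) * \det (col_mx (rowsub h Y) Z).
  pose c (u : 'S_q) (h : {ffun 'I_q -> 'I_p}) : {ffun 'I_q -> 'I_p} :=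
    [ffun i => h (u i)].
  rewrite (reindex (c t)) /=; last first.
    by exists (c t^-1%g) => h _; apply/ffunP=> i; rewrite !ffunE ?permK ?permKV.
  apply: eq_bigr => h _; rewrite det_col_mx_rowsub_perm [RHS]mulrAC -[RHS]mulrC.
  by congr (_ * _); apply: eq_bigr => i _; rewrite ffunE.
rewrite mulr_natl -card_Sn -sumr_const.
under eq_bigr => t _ do rewrite (perm_sum t).
rewrite exchange_big /=; apply: eq_bigr => h _.
rewrite -big_distrl /=; congr (_ * _); rewrite /determinant.
apply: eq_big => [t|t _]; first by rewrite inE.
by congr (_ * _); apply: eq_bigr => i _; rewrite mxE.
Qed.

Corollary cauchy_binet p q (X : 'M[R]_(q, p)) (Y : 'M[R]_(p, q)) :
  q`!%:R * \det (X *m Y) =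
  \sum_(h : {ffun 'I_q -> 'I_p}) \det (colsub h X) * \det (rowsub h Y).
Proof.
have := @cauchy_binet_rows p q 1 X (row_mx Y 0) (row_mx 0 1%:M).
rewrite mul_mx_row mulmx0 -block_mxEv det_ublock det1 mulr1 => ->.
apply: eq_bigr => h _; congr (_ * _).
have -> : rowsub h (row_mx Y 0) = row_mx (rowsub h Y) (0 : 'M_(q, 1)).
  by apply/matrixP=> i j; rewrite !mxE; case: split => ?; rewrite !mxE.
by rewrite -block_mxEv det_ublock det1 mulr1.
Qed.

Corollary det_gram p q (A : 'M[R]_(p, q)) :
  q`!%:R * \det (A^T *m A) =
  \sum_(h : {ffun 'I_q -> 'I_p}) \det (rowsub h A) ^+ 2.
Proof.
rewrite cauchy_binet; apply: eq_bigr => h _; rewrite expr2; congr (_ * _).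
by rewrite -det_tr; congr (\det _); apply/matrixP=> i j; rewrite !mxE.
Qed.

(** Sylvester's identity: the block matrix with diagonal blocks 1 and
    off-diagonal blocks - U, V can be triangularised from either side. *)
Lemma det_add1_mulC p q (U : 'M[R]_(p, q)) (V : 'M[R]_(q, p)) :
  \det (1%:M + U *m V) = \det (1%:M + V *m U).
Proof.
pose B : 'M_(p + q) := block_mx 1%:M (- U) V 1%:M.
transitivity (\det B).
  transitivity (\det (block_mx 1%:M U 0 1%:M *m B)).
    rewrite mulmx_block !mul1mx !mul0mx !add0r mulmx1 addNr.
    by rewrite det_lblock det1 mulr1.
  by rewrite det_mulmx det_ublock !det1 !mul1r.
transitivity (\det (B *m block_mx 1%:M U 0 1%:M)).
  by rewrite det_mulmx det_ublock !det1 !mulr1.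
rewrite mulmx_block !mulmx0 !mul1mx !mulmx1 !addr0 subrr.
by rewrite det_lblock det1 mul1r addrC.
Qed.

End Determinants.

(** The scalar factor is the Schur complement of G. *)
Lemma det_bordered (F : fieldType) q (G : 'M[F]_q) (b : 'cV[F]_q)
    (c : 'rV[F]_q) (d : 'M[F]_1) : G \in unitmx ->
  \det (block_mx G b c d) = \det G * (d - c *m invmx G *m b) 0 0.
Proof.
move=> uG; set S := d - _.
have -> : block_mx G b c d
    = block_mx G 0 c S *m block_mx 1%:M (invmx G *m b) 0 1%:M.
  rewrite mulmx_block !mulmx1 !mulmx0 !addr0 mulKVmx // mulmxA.
  by rewrite /S addrC subrK.
by rewrite det_mulmx det_lblock det_ublock !det1 !mulr1 det_mx11.
Qed.
(** * Sums over sets and sums over tuples *)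

Section SetsAndTuples.
Variable R : numDomainType.
Implicit Types q n : nat.

Definition enum_ffun n (J : {set 'I_n}) : {ffun 'I_#|J| -> 'I_n} :=
  [ffun a => enum_val a].

Lemma fact_neq0 q : q`!%:R != 0 :> R.
Proof. by rewrite pnatr_eq0 -lt0n fact_gt0. Qed.

Lemma card_inj_ffun_image q n (J : {set 'I_n}) : #|J| = q ->
  #|[set g : {ffun 'I_q -> 'I_n} | injectiveb g && (g @: setT == J)]| = q`!.
Proof.
move=> cJ; transitivity (#|J| ^_ #|'I_q|); last first.
  by rewrite cJ card_ord ffactnn.
rewrite -card_inj_ffuns_on; apply: eq_card => g; rewrite !inE.
rewrite andbC; apply: andb_id2r => /injectiveP gI.
rewrite eqEcard card_imset // cardsT card_ord cJ leqnn andbT.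
apply/subsetP/forallP => [sJ i|fJ _ /imsetP[i _ ->]]; last exact: fJ.
by apply: sJ; apply: imset_f.
Qed.

Lemma eq_image_perm q n (g e : {ffun 'I_q -> 'I_n}) :
  injective e -> e @: setT = g @: setT ->
  exists s : 'S_q, e = [ffun i => g (s i)].
Proof.
move=> eI eg.
have cod i : e i \in codom g.
  have : e i \in g @: setT by rewrite -eg imset_f.
  by case/imsetP=> j _ ->; apply: codom_f.
have sI : injective (fun i => iinv (cod i)).
  by move=> i j /(congr1 g); rewrite !f_iinv => /eI.
by exists (perm sI); apply/ffunP=> i; rewrite ffunE permE f_iinv.
Qed.

(** X is a family over all lengths q because the increasing enumeration of J has
    length #|J|, which equals k only propositionally. *)
Lemma sum_qsubsets k n (X : forall q, {ffun 'I_q -> 'I_n} -> R) :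
  (forall q (g : {ffun 'I_q -> 'I_n}) (s : 'S_q),
      X q [ffun i => g (s i)] = X q g) ->
  (forall q (g : {ffun 'I_q -> 'I_n}), ~~ injectiveb g -> X q g = 0) ->
  \sum_(g : {ffun 'I_k -> 'I_n}) X k g =
  k`!%:R * \sum_(J in qsubsets k n) X #|J| (enum_ffun J).
Proof.
move=> Xperm X0; rewrite (bigID (fun g : {ffun _ -> _} => injectiveb g)) /=.
rewrite [X in _ + X]big1 ?addr0 // => [|g]; last exact: X0.
rewrite (partition_big (fun g : {ffun 'I_k -> 'I_n} => g @: setT)
  (mem (qsubsets k n))) /=; last first.
  by move=> g /injectiveP gI; rewrite inE card_imset // cardsT card_ord.
rewrite big_distrr /=; apply: eq_bigr => J; rewrite inE => /eqP cJ.
rewrite -(card_inj_ffun_image cJ) mulr_natl -sumr_const.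
apply: eq_big => [g|g /andP[gI /eqP gJ]]; first by rewrite inE.
have eI : injective (enum_ffun J) by move=> a b; rewrite !ffunE => /enum_val_inj.
have eJ : enum_ffun J @: setT = g @: setT.
  rewrite gJ; apply/setP=> x; apply/imsetP/idP => [[a _ ->]|xJ].
    by rewrite ffunE enum_valP.
  by exists (enum_rank_in xJ x); rewrite ?inE // ffunE enum_rankK_in.
move: (enum_ffun J) eI eJ cJ.
move: (#|J|) => q e eI eJ qk; move: qk e eI eJ => -> e eI.
case/(eq_image_perm eI)=> s ->.
by rewrite Xperm.
Qed.

Lemma sum_enum_val_ffun q n (I : {set 'I_n}) (F : {ffun 'I_q -> 'I_n} -> R) :
  \sum_(h : {ffun 'I_q -> 'I_#|I|}) F [ffun x => enum_val (h x)] =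
  \sum_(f : {ffun 'I_q -> 'I_n} | f @: setT \subset I) F f.
Proof.
pose c (h : {ffun 'I_q -> 'I_#|I|}) : {ffun 'I_q -> 'I_n} :=
  [ffun x => enum_val (h x)].
have cI : injective c.
  move=> h1 h2 /ffunP h12; apply/ffunP=> x.
  by have := h12 x; rewrite !ffunE => /enum_val_inj.
(* A partial inverse of c needs no default element, hence covers an empty I. *)
rewrite (reindex_omap c (fun f => [pick h | c h == f])) /=; last first.
  move=> f /subsetP fI.
  have fxI x : f x \in I by apply: fI; apply: imset_f.
  case: pickP => [h /eqP /= -> //|] /(_ [ffun x => enum_rank_in (fxI x) (f x)]).
  move=> /eqP[]; apply/ffunP=> x.
  by rewrite !ffunE enum_rankK_in.
apply: eq_bigl => h; symmetry; apply/andP; split.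
  by apply/subsetP=> _ /imsetP[x _ ->]; rewrite ffunE enum_valP.
by case: pickP => [h' /eqP /cI -> //|/(_ h)]; rewrite eqxx.
Qed.

Definition ffun_snoc q (T : Type) (f : {ffun 'I_q -> T}) (t : T) :
    {ffun 'I_(q + 1) -> T} :=
  [ffun a => if split a is inl b then f b else t].

Lemma ffun_snoc_l q (T : Type) (f : {ffun 'I_q -> T}) t b :
  ffun_snoc f t (lshift 1 b) = f b.
Proof. by rewrite ffunE (unsplitK (inl b)). Qed.

Lemma ffun_snoc_r q (T : Type) (f : {ffun 'I_q -> T}) t b :
  ffun_snoc f t (rshift q b) = t.
Proof. by rewrite ffunE (unsplitK (inr b)). Qed.

Lemma sum_ffun_snoc q (T : finType) (F : {ffun 'I_(q + 1) -> T} -> R) :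
  \sum_f F f = \sum_(f : {ffun 'I_q -> T}) \sum_t F (ffun_snoc f t).
Proof.
rewrite pair_big /= (reindex (fun p => ffun_snoc p.1 p.2)) //=.
exists (fun f => ([ffun b => f (lshift 1 b)], f (rshift q 0))) => [[f t]|f] _ /=.
  congr (_, _); last by rewrite ffun_snoc_r.
  by apply/ffunP=> b; rewrite ffunE ffun_snoc_l.
apply/ffunP=> a; rewrite -[a]splitK; case: (split a) => b.
  by rewrite ffun_snoc_l ffunE.
by rewrite ffun_snoc_r [b]ord1.
Qed.

Lemma ffun_snoc_noninj q (T : finType) (f : {ffun 'I_q -> T}) t :
  ~~ injectiveb f -> ~~ injectiveb (ffun_snoc f t).
Proof.
case/injectivePn=> a [b ab fab]; apply/injectivePn.
by exists (lshift 1 a), (lshift 1 b); rewrite ?ffun_snoc_l //.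
Qed.

(** Complements of such supersets are the subsets of size n - r of the complement
    of S.  This form of the binomial is also right when r < #|S|: it is then
    zero. *)
Lemma card_supersets n r (S : {set 'I_n}) : (r <= n)%N ->
  #|[set I in qsubsets r n | S \subset I]| = 'C(n - #|S|, n - r).
Proof.
move=> rn; have -> : (n - #|S|)%N = #|~: S|%N by rewrite [RHS]cardsCs setCK card_ord.
rewrite -cards_draws.
rewrite -[LHS](card_imset _ (@setC_inj _)); apply: eq_card => I.
rewrite !inE; apply/imsetP/andP => [[K + ->]|[IS /eqP cI]].
  by rewrite !inE setCS => /andP[/eqP <- ->]; split=> //; rewrite cardsCs setCK card_ord.
exists (~: I); rewrite ?setCK // !inE subsetC IS andbT.
by rewrite cardsCs setCK card_ord cI subKn.
Qed.

(** The supersets of S that contain i are the supersets of i |: S. *)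
Lemma card_supersets_avoiding n r (S : {set 'I_n}) i : (r <= n)%N ->
    i \notin S ->
  #|[set I in qsubsets r n | (S \subset I) && (i \notin I)]|%:R =
  'C(n - #|S|, n - r)%:R - 'C(n - #|S|.+1, n - r)%:R :> R.
Proof.
move=> rn iS; apply/eqP; rewrite eq_sym subr_eq -natrD -!card_supersets //.
have cS : #|S|.+1 = #|i |: S| by rewrite cardsU1 iS.
rewrite cS -card_supersets // eqr_nat -(cardsID [set I : {set _} | i \in I]) addnC.
apply/eqP; congr (_ + _)%N; apply: eq_card => I; rewrite !inE.
  by rewrite andbC -andbA.
by rewrite subUset sub1set -andbA [(S \subset _) && _]andbC.
Qed.

End SetsAndTuples.
(** * Minors indexed by tuples *)

Section Minors.
Variable R : comNzRingType.

Lemma det_mxsub_perm m n q (M : 'M[R]_(m, n)) (f : {ffun 'I_q -> 'I_m})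
    (g : {ffun 'I_q -> 'I_n}) (s : 'S_q) :
  \det (mxsub f [ffun i => g (s i)] M) = (-1) ^+ s * \det (mxsub f g M).
Proof.
have -> : mxsub f [ffun i => g (s i)] M = col_perm s (mxsub f g M).
  by apply/matrixP=> i j; rewrite !mxE ffunE.
by rewrite col_permE det_mulmx det_perm odd_permV mulrC.
Qed.

Lemma det_mxsub_noninj_l m n q (M : 'M[R]_(m, n)) (f : {ffun 'I_q -> 'I_m})
    (g : {ffun 'I_q -> 'I_n}) : ~~ injectiveb f -> \det (mxsub f g M) = 0.
Proof.
case/injectivePn=> a [b neq_ab fab]; apply: (determinant_alternate neq_ab) => j.
by rewrite !mxE fab.
Qed.

Lemma det_mxsub_tr m n q (M : 'M[R]_(m, n)) (f : {ffun 'I_q -> 'I_m})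
    (g : {ffun 'I_q -> 'I_n}) : \det (mxsub g f M^T) = \det (mxsub f g M).
Proof.
by rewrite -det_tr; congr (\det _); apply/matrixP=> i j; rewrite !mxE.
Qed.

Lemma det_mxsub_noninj_r m n q (M : 'M[R]_(m, n)) (f : {ffun 'I_q -> 'I_m})
    (g : {ffun 'I_q -> 'I_n}) : ~~ injectiveb g -> \det (mxsub f g M) = 0.
Proof. by move=> gN; rewrite -det_mxsub_tr det_mxsub_noninj_l. Qed.

Lemma mxsub_ffun_snoc m n q (M : 'M[R]_(m, n)) (f : {ffun 'I_q -> 'I_m})
    (g : {ffun 'I_q -> 'I_n}) i j :
  mxsub (ffun_snoc f i) (ffun_snoc g j) M =
  block_mx (mxsub f g M) (\col_a M (f a) j) (\row_b M i (g b)) (M i j)%:M.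
Proof.
apply/matrixP=> a b; rewrite -[a]splitK -[b]splitK.
case: (split a) (split b) => a' [] b' /=;
  rewrite mxE ?ffun_snoc_l ?ffun_snoc_r ?block_mxEul ?block_mxEur
    ?block_mxEdl ?block_mxEdr !mxE //.
by rewrite [a']ord1 [b']ord1.
Qed.

End Minors.

(** * Principal minors and the characteristic polynomial *)

Section CharPoly.
Variable R : comNzRingType.

(** Its determinant is the principal minor of A on S ([det_principal_mx]), but
    its dimension does not depend on S, so that it has a Leibniz expansion over
    the same permutations as A. *)
Definition principal_mx n (S : {set 'I_n}) (A : 'M[R]_n) : 'M[R]_n :=
  \matrix_(i, j) if i \in S then A i j else (i == j)%:R.

(** Distribute each row of the matrix over its X part and its A part; S is the set
    of the rows in which A was chosen. *)
Lemma char_poly_principal n (A : 'M[R]_n) :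
  char_poly A = \sum_(S : {set 'I_n})
    ((-1) ^+ #|S| * \det (principal_mx S A))%:P * 'X^(n - #|S|).
Proof.
rewrite /char_poly /determinant.
transitivity (\sum_(t : 'S_n) \sum_(S : {set 'I_n}) (-1) ^+ t *
   \prod_i (if i \in S then - (A i (t i))%:P else 'X *+ (i == t i))).
  apply: eq_bigr => t _; rewrite -big_distrr /= -bigA_distr; congr (_ * _).
  by apply: eq_bigr => i _; rewrite !mxE addrC.
rewrite exchange_big /=; apply: eq_bigr => S _.
have -> : 'X^(n - #|S|) = \prod_(i in ~: S) 'X :> {poly R}.
  by rewrite prodr_const [in RHS]cardsCs setCK card_ord.
rewrite polyCM rmorphXn /= polyCN -prodr_const.
rewrite rmorph_sum /= mulrAC big_distrr /=; apply: eq_bigr => t _.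
rewrite rmorphM rmorphXn /= polyCN rmorph_prod /= mulrCA; congr (_ * _).
rewrite [X in X * _ * _]big_mkcond [X in _ * X * _]big_mkcond /=.
rewrite -!big_split /=; apply: eq_bigr => i _; rewrite !mxE inE.
by case: (i \in S); rewrite /= ?mul1r ?mulr1 ?mulN1r // polyCMn mulr_natr.
Qed.

Lemma eq_char_poly_principal n (A B : 'M[R]_n) k :
  char_poly A = char_poly B ->
  \sum_(S in qsubsets k n) \det (principal_mx S A) =
  \sum_(S in qsubsets k n) \det (principal_mx S B).
Proof.
have coefE (C : 'M[R]_n) : (k <= n)%N -> (char_poly C)`_(n - k) =
    (-1) ^+ k * \sum_(S in qsubsets k n) \det (principal_mx S C).
  move=> kn; rewrite char_poly_principal coef_sum [in RHS]big_mkcond /=.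
  rewrite big_distrr /=.
  apply: eq_bigr => S _; rewrite coefCM coefXn inE.
  have cS : (#|S| <= n)%N by rewrite -[X in (_ <= X)%N]card_ord max_card.
  have -> : (n - k == n - #|S|)%N = (#|S| == k).
    by apply/eqP/eqP => [/(congr1 (subn n))|->] //; rewrite !subKn.
  by case: eqP => [->|]; rewrite ?mulr1 // !mulr0.
move=> AB; have [kn|nk] := leqP k n; last first.
  by rewrite !big1 // => S; rewrite inE => /eqP cS;
    move: nk; rewrite -cS ltnNge -[X in (_ <= X)%N]card_ord max_card.
have := coefE A kn; rewrite AB coefE // => /(congr1 (fun x => (-1) ^+ k * x)).
by rewrite !mulrA -expr2 sqrr_sign !mul1r.
Qed.

(** With P the selection of the rows in S, the left matrix is
    1 + P^T (P A - P), and Sylvester's identity moves P^T to the right, where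
    P P^T = 1 leaves P A P^T. *)
Lemma det_principal_mx n (S : {set 'I_n}) (A : 'M[R]_n) :
  \det (principal_mx S A) =
  \det (mxsub (enum_val : 'I_#|S| -> 'I_n) (enum_val : 'I_#|S| -> 'I_n) A).
Proof.
pose P : 'M[R]_(#|S|, n) := rowsub enum_val 1%:M.
have PE q (Y : 'M[R]_(n, q)) : P *m Y = rowsub enum_val Y.
  by rewrite /P mul_rowsub_mx mul1mx.
have -> : principal_mx S A = 1%:M + P^T *m (P *m A - P).
  apply/matrixP=> i j; rewrite !mxE.
  under eq_bigr => a _ do rewrite PE /P !mxE.
  rewrite -(big_enum_val (fun l => (l == i)%:R * (A l j - (l == j)%:R))) /=.
  case: ifPn => iS.
    rewrite (bigD1 i) //= eqxx mul1r big1 ?addr0 => [|l /andP[_ /negPf->]].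
      by rewrite addrC subrK.
    by rewrite mul0r.
  rewrite big1 ?addr0 // => l lS; case: eqP => [li|]; last by rewrite mul0r.
  by rewrite -li lS in iS.
rewrite det_add1_mulC mulmxBl PE; congr (\det _).
have -> : P *m P^T = 1%:M.
  rewrite PE; apply/matrixP=> a b; rewrite !mxE eq_sym.
  by rewrite (inj_eq enum_val_inj).
rewrite addrC subrK -[_ *m P^T]trmxK trmx_mul trmxK PE.
by apply/matrixP=> a b; rewrite !mxE.
Qed.

Lemma det_principal_diag n (S : {set 'I_n}) (d : 'I_n -> R) :
  \det (principal_mx S (diag_mx (\row_i d i))) = \prod_(i in S) d i.
Proof.
have -> : principal_mx S (diag_mx (\row_i d i)) =
    diag_mx (\row_i if i \in S then d i else 1).
  apply/matrixP=> i j; rewrite !mxE; case: (i \in S) => //.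
rewrite det_diag [RHS]big_mkcond; apply: eq_bigr => i _.
by rewrite mxE.
Qed.

End CharPoly.

(** * Elementary symmetric sums *)

Section ElementarySymmetric.
Variable R : numDomainType.

Lemma sum_det_mxsub_principal k n (A : 'M[R]_n) :
  \sum_(g : {ffun 'I_k -> 'I_n}) \det (mxsub g g A) =
  k`!%:R * \sum_(S in qsubsets k n) \det (principal_mx S A).
Proof.
rewrite (sum_qsubsets k (X := fun q g => \det (mxsub g g A))) => [|q g s|q g].
- congr (_ * _); apply: eq_bigr => S _; rewrite det_principal_mx.
  by congr (\det _); apply/matrixP=> i j; rewrite !mxE !ffunE.
- rewrite det_mxsub_perm -det_mxsub_tr det_mxsub_perm det_mxsub_tr.
  by rewrite mulrA -expr2 sqrr_sign mul1r.
- exact: det_mxsub_noninj_l.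
Qed.

Lemma exists_large_elem k n (S : {set 'I_n}) : #|S| = k.+1 ->
  exists2 i : 'I_n, i \in S & (k <= i)%N.
Proof.
move=> cS; apply/exists_inP; rewrite -[X in is_true X]negbK negb_exists_in.
apply/negP => /forall_inP Sk.
suff : (#|S| <= k)%N by rewrite cS ltnn.
rewrite -[k in (_ <= k)%N](size_iota 0) cardE -(size_map val).
apply: uniq_leq_size; first by rewrite map_inj_uniq ?enum_uniq //; exact: val_inj.
move=> _ /mapP[i + ->]; rewrite mem_enum mem_iota add0n /= => /Sk.
by rewrite -ltnNge.
Qed.

(** Each set S of k + 1 indices contains some i >= k; splitting off the factor d i
    leaves a product over a set of size k.  Summing over every such i only
    increases the left-hand side. *)
Lemma esym_tail_le k n (d : 'I_n -> R) : (forall i, 0 <= d i) ->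
  \sum_(S in qsubsets k.+1 n) \prod_(i in S) d i <=
  (\sum_(i < n | (k <= i)%N) d i) * \sum_(S in qsubsets k n) \prod_(i in S) d i.
Proof.
move=> d0; have P0 (S : {set 'I_n}) : 0 <= \prod_(i in S) d i by exact: prodr_ge0.
pose t (S : {set 'I_n}) (i : 'I_n) := d i * \prod_(l in S :\ i) d l.
apply: (@le_trans _ _ (\sum_(S in qsubsets k.+1 n)
   \sum_(i < n | (k <= i)%N && (i \in S)) t S i)).
  apply: ler_sum => S; rewrite inE => /eqP /exists_large_elem[i iS ki].
  rewrite (big_setD1 i) //= [leRHS](bigD1 i) ?ki ?iS //= lerDl.
  by apply: sumr_ge0 => j _; rewrite mulr_ge0.
under eq_bigr => S _ do rewrite big_mkcondr /=.
rewrite exchange_big /= big_distrl /=; apply: ler_sum => i _.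
rewrite -big_mkcondr /= -big_distrr /= ler_wpM2l //.
rewrite (reindex_onto (fun S => i |: S) (fun S => S :\ i)) /=; last first.
  by move=> S /andP[_ iS]; rewrite setD1K.
rewrite [leRHS](bigID (fun S : {set 'I_n} => i \notin S)) /=.
rewrite -[leLHS]addr0 lerD ?sumr_ge0 // le_eqVlt; apply/orP; left; apply/eqP.
apply: eq_big => [S|S /andP[_ /eqP -> //]].
rewrite !inE eqxx /= andbT; have [iS|iS] := boolP (i \in S).
  rewrite andbF; apply/negP => /andP[_ /eqP/setP/(_ i)].
  by rewrite !inE eqxx iS.
by rewrite setU1K // eqxx !andbT cardsU1 iS add1n eqSS.
Qed.

End ElementarySymmetric.
(** * Residuals of the least-squares fit *)

Section LeastSquaresResiduals.
Variable R : realType.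
Implicit Types p q : nat.

Lemma pinv_gram p q (A : 'M[R]_(p, q)) :
  A^T *m A \in unitmx -> pinv A = invmx (A^T *m A) *m A^T.
Proof.
move=> uG; symmetry; apply: pinv_uniq; split.
- by rewrite -!mulmxA mulVmx // mulmx1.
- by rewrite -!mulmxA (mulmxA A^T) mulKmx.
- by rewrite mulmxA !trmx_mul trmxK trmx_inv trmx_mul trmxK mulmxA.
- by rewrite -mulmxA mulVmx // trmx1.
Qed.

(** The Schur complement of A^T A in the Gram matrix of (A | b) is
    b^T b - b^T A A^+ b, the squared distance from b to the column space of A. *)
Lemma det_gram_residual p q (A : 'M[R]_(p, q)) (b : 'cV[R]_p) :
  A^T *m A \in unitmx ->
  \det (A^T *m A) * (\sum_l ((b - A *m pinv A *m b) l 0) ^+ 2) =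
  \det ((row_mx A b)^T *m row_mx A b).
Proof.
move=> uG; rewrite tr_row_mx mul_col_row det_bordered //; congr (_ * _).
have [APA _ APs _] := pinvP A; set v := b - _.
transitivity ((v^T *m v) 0 0).
  by rewrite [RHS]mxE; apply: eq_bigr => l _; rewrite [v^T _ _]mxE expr2.
congr (fun B : 'M_1 => B 0 0).
have vAP : v^T *m (A *m pinv A) = 0.
  rewrite /v linearB /= trmx_mul APs mulmxBl -!mulmxA [A *m (_ *m _)]mulmxA.
  by rewrite [A *m pinv A *m _]mulmxA APA subrr.
rewrite {2}/v mulmxBr mulmxA vAP mul0mx subr0 /v linearB /= trmx_mul APs.
by rewrite mulmxBl pinv_gram // !mulmxA.
Qed.

(** With x h = det A_h, y h the bordered minor and rho the residual on the left,
    Cauchy-Binet gives sum x^2 = N and sum x y = N rho, where N = q! det (A^T A);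
    the claim is that the sum of the (y - rho x)^2 is nonnegative. *)
Lemma det_bordered_residual_le p q (A : 'M[R]_(p, q)) (b : 'cV[R]_p)
    (c : 'rV[R]_q) (d : 'M[R]_1) : A^T *m A \in unitmx ->
  q`!%:R * \det (A^T *m A) * ((d - c *m pinv A *m b) 0 0) ^+ 2 <=
  \sum_(h : {ffun 'I_q -> 'I_p})
    \det (block_mx (rowsub h A) (rowsub h b) c d) ^+ 2.
Proof.
move=> uG; set rho := (d - _) 0 0.
pose x (h : {ffun 'I_q -> 'I_p}) := \det (rowsub h A).
pose y (h : {ffun 'I_q -> 'I_p}) :=
  \det (block_mx (rowsub h A) (rowsub h b) c d).
have xx : \sum_h x h ^+ 2 = q`!%:R * \det (A^T *m A) by rewrite det_gram.
have xy : \sum_h x h * y h = q`!%:R * \det (A^T *m A) * rho.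
  rewrite -mulrA /rho pinv_gram // mulmxA -(mulmxA _ A^T) -det_bordered //.
  rewrite block_mxEv -mul_mx_row cauchy_binet_rows; apply: eq_bigr => h _.
  congr (_ * _).
    by rewrite -[RHS]det_tr; congr (\det _); apply/matrixP=> i j; rewrite !mxE.
  rewrite /y block_mxEv; congr (\det (col_mx _ _)).
  by apply/matrixP=> i j; rewrite !mxE; case: split => ?; rewrite !mxE.
rewrite -subr_ge0 -/y.
have -> : \sum_h y h ^+ 2 - q`!%:R * \det (A^T *m A) * rho ^+ 2 =
    \sum_h (y h - rho * x h) ^+ 2.
  have -> : \sum_h (y h - rho * x h) ^+ 2 = \sum_h y h ^+ 2
      - rho *+ 2 * (\sum_h x h * y h) + rho ^+ 2 * (\sum_h x h ^+ 2).
    rewrite !big_distrr /= -sumrB -big_split /=; apply: eq_bigr => h _.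
    by ring.
  by rewrite xx xy; ring.
by apply: sumr_ge0 => h _; exact: sqr_ge0.
Qed.

End LeastSquaresResiduals.

(** * Squared minors and the error of the approximation *)

Section SquaredMinors.
Variables (R : realType) (m n : nat) (M : 'M[R]_(m, n)).
Implicit Types (I : {set 'I_m}) (J : {set 'I_n}) (q r k : nat).

Definition sqminor q (f : {ffun 'I_q -> 'I_m}) (g : {ffun 'I_q -> 'I_n}) : R :=
  \det (mxsub f g M) ^+ 2.

Lemma sqminor_perm q (f : {ffun 'I_q -> 'I_m}) (g : {ffun 'I_q -> 'I_n})
    (s : 'S_q) :
  sqminor f [ffun i => g (s i)] = sqminor f g.
Proof. by rewrite /sqminor det_mxsub_perm exprMn sqrr_sign mul1r. Qed.

Lemma sqminor_noninj_l q (f : {ffun 'I_q -> 'I_m}) (g : {ffun 'I_q -> 'I_n}) :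
  ~~ injectiveb f -> sqminor f g = 0.
Proof. by move=> fN; rewrite /sqminor det_mxsub_noninj_l // expr0n. Qed.

Lemma sqminor_noninj_r q (f : {ffun 'I_q -> 'I_m}) (g : {ffun 'I_q -> 'I_n}) :
  ~~ injectiveb g -> sqminor f g = 0.
Proof. by move=> gN; rewrite /sqminor det_mxsub_noninj_r // expr0n. Qed.

Lemma sqminor_snoc_perm q (f : {ffun 'I_(q + 1) -> 'I_m})
    (g : {ffun 'I_q -> 'I_n}) (s : 'S_q) j :
  sqminor f (ffun_snoc [ffun i => g (s i)] j) = sqminor f (ffun_snoc g j).
Proof.
rewrite /sqminor.
have -> : mxsub f (ffun_snoc [ffun i => g (s i)] j) M =
    mxsub f (ffun_snoc g j) M *m block_mx (perm_mx s^-1) 0 0 (1%:M : 'M_1).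
  rewrite -[mxsub f (ffun_snoc g j) M]hsubmxK mul_row_block !mulmx0.
  rewrite addr0 add0r mulmx1 -col_permE.
  apply/matrixP=> a b; rewrite -[b]splitK; case: (split b) => b' /=.
    by rewrite row_mxEl !mxE !ffun_snoc_l ffunE.
  by rewrite row_mxEr !mxE !ffun_snoc_r.
rewrite det_mulmx det_ublock det1 mulr1 det_perm exprMn sqrr_sign mulr1 //.
Qed.

(** [volume_sum], [inner_error] and [outer_error] are symmetric in the tuple g and
    vanish when g has a repetition, so that [sum_qsubsets] applies to them.  On
    the enumeration of J, [volume_sum] is the volume of (I, J), [inner_error] the
    error made on the rows in I, weighted by the volume, and [outer_error] an
    upper bound for the weighted error on the other rows. *)
Definition volume_sum I q (g : {ffun 'I_q -> 'I_n}) : R :=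
  q`!%:R^-1 * \sum_(f : {ffun 'I_q -> 'I_m} | f @: setT \subset I) sqminor f g.

Definition inner_error I q (g : {ffun 'I_q -> 'I_n}) : R :=
  (q + 1)`!%:R^-1 * \sum_j
    \sum_(f : {ffun 'I_(q + 1) -> 'I_m} | f @: setT \subset I)
      sqminor f (ffun_snoc g j).

Definition outer_error I q (g : {ffun 'I_q -> 'I_n}) : R :=
  q`!%:R^-1 * \sum_j \sum_(i | i \notin I)
    \sum_(f : {ffun 'I_q -> 'I_m} | f @: setT \subset I)
      sqminor (ffun_snoc f i) (ffun_snoc g j).

Lemma vol2_sqminor I J : vol2 M I J = volume_sum I (enum_ffun J).
Proof.
apply: (mulfI (fact_neq0 R #|J|)); rewrite /volume_sum mulVKf ?fact_neq0 //.
rewrite /vol2 det_gram -sum_enum_val_ffun; apply: eq_bigr => h _.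
congr (_ ^+ 2); congr (\det _).
by apply/matrixP=> a b; rewrite !mxE !ffunE.
Qed.

Lemma CUR_residualE I J i j :
  (M - CUR M I J) i j =
  ((M i j)%:M - row i (cols J M) *m pinv (submx_IJ I J M)
    *m col j (rows I M)) 0 0.
Proof.
rewrite /CUR -row_mul; set X := cols J M *m _.
rewrite mxE [RHS]mxE; congr (_ + _); first by rewrite !mxE.
rewrite mxE [RHS]mxE; congr (- _).
rewrite mxE [RHS]mxE; apply: eq_bigr => a _.
by rewrite [row _ _ _ _]mxE [col _ _ _ _]mxE.
Qed.

Lemma inner_residuals I J : vol2 M I J != 0 ->
  vol2 M I J * (\sum_(i in I) \sum_j ((M - CUR M I J) i j) ^+ 2) =
  inner_error I (enum_ffun J).
Proof.
move=> V0; have uG : (submx_IJ I J M)^T *m submx_IJ I J M \in unitmx.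
  by rewrite unitmxE unitfE.
rewrite exchange_big /inner_error !big_distrr /=; apply: eq_bigr => j _.
rewrite big_enum_val /=; pose b : 'cV_#|I| := col j (rows I M).
transitivity (vol2 M I J *
    \sum_l ((b - submx_IJ I J M *m pinv (submx_IJ I J M) *m b) l 0) ^+ 2).
  congr (_ * _); apply: eq_bigr => l _; rewrite CUR_residualE; congr (_ ^+ 2).
  rewrite mxE [RHS]mxE; congr (_ + _); first by rewrite !mxE.
  rewrite mxE [RHS]mxE; congr (- _).
  have -> : row (enum_val l) (cols J M) = row l (submx_IJ I J M).
    by apply/rowP=> a; rewrite !mxE.
  by rewrite -!row_mul mxE.
rewrite det_gram_residual //; apply: (mulfI (fact_neq0 R (#|J| + 1))).
rewrite det_gram mulVKf ?fact_neq0 // -sum_enum_val_ffun.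
apply: eq_bigr => h _; congr (_ ^+ 2); congr (\det _).
apply/matrixP=> a c; rewrite -[c]splitK !mxE; case: (split c) => c' /=.
  by rewrite (unsplitK (inl c')) !mxE !ffunE (unsplitK (inl c')) !ffunE.
by rewrite (unsplitK (inr c')) !mxE !ffunE (unsplitK (inr c')).
Qed.

Lemma outer_residuals I J : vol2 M I J != 0 ->
  vol2 M I J * (\sum_(i | i \notin I) \sum_j ((M - CUR M I J) i j) ^+ 2) <=
  outer_error I (enum_ffun J).
Proof.
move=> V0; have uG : (submx_IJ I J M)^T *m submx_IJ I J M \in unitmx.
  by rewrite unitmxE unitfE.
rewrite exchange_big /outer_error !big_distrr /=; apply: ler_sum => j _.
rewrite !big_distrr /=; apply: ler_sum => i _.
rewrite -(ler_pM2l (x := (#|J|)`!%:R)) ?ltr0n ?fact_gt0 //.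
rewrite mulVKf ?fact_neq0 // mulrA.
pose b : 'cV_#|I| := col j (rows I M); pose c : 'rV_#|J| := row i (cols J M).
have -> : (M - CUR M I J) i j =
    ((M i j)%:M - c *m pinv (submx_IJ I J M) *m b) 0 0.
  exact: CUR_residualE.
apply: le_trans (det_bordered_residual_le b c _ uG) _.
rewrite -sum_enum_val_ffun le_eqVlt; apply/orP; left; apply/eqP.
apply: eq_bigr => h _; rewrite /sqminor mxsub_ffun_snoc.
congr (\det (block_mx _ _ _ _) ^+ 2);
  by apply/matrixP=> x y; rewrite !mxE ?ffunE.
Qed.


Lemma vol2_ge0 I J : 0 <= vol2 M I J.
Proof.
rewrite vol2_sqminor mulr_ge0 ?invr_ge0 ?ler0n //.
by apply: sumr_ge0 => f _; exact: sqr_ge0.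
Qed.

Lemma vol2_error_le I J :
  vol2 M I J * frobenius_norm (M - CUR M I J) ^+ 2 <=
  inner_error I (enum_ffun J) + outer_error I (enum_ffun J).
Proof.
have [V0|V0] := eqVneq (vol2 M I J) 0.
  rewrite V0 mul0r /inner_error /outer_error.
  by rewrite addr_ge0 // mulr_ge0 ?invr_ge0 ?ler0n //; apply: sumr_ge0 => j _;
    apply: sumr_ge0 => f _; rewrite ?sumr_ge0 // => *; exact: sqr_ge0.
rewrite /frobenius_norm sqr_sqrtr; last first.
  by apply: sumr_ge0 => i _; apply: sumr_ge0 => j _; exact: sqr_ge0.
rewrite (bigID (fun i => i \in I)) /= mulrDr lerD ?outer_residuals //.
by rewrite inner_residuals.
Qed.

Lemma sum_supersets q r (F : {ffun 'I_q -> 'I_m} -> R) : (r <= m)%N ->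
  (forall f : {ffun 'I_q -> 'I_m}, ~~ injectiveb f -> F f = 0) ->
  \sum_(I in qsubsets r m)
    \sum_(f : {ffun 'I_q -> 'I_m} | f @: setT \subset I) F f
  = 'C(m - q, m - r)%:R * \sum_f F f.
Proof.
move=> rm F0; under eq_bigr => I _ do rewrite big_mkcond /=.
rewrite exchange_big big_distrr /=; apply: eq_bigr => f _.
have [/injectiveP fI|fN] := boolP (injectiveb f); last first.
  by rewrite F0 // mulr0 big1 // => I _; rewrite if_same.
rewrite -big_mkcondr /= sumr_const mulr_natl; congr (_ *+ _).
rewrite -[q in RHS]card_ord -cardsT -(card_imset _ fI) -card_supersets //.
by apply: eq_card => I; rewrite unfold_in !inE.
Qed.

(** The new entry i must avoid I while the tuple f stays in I, whence the
    difference of two counts. *)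
Lemma sum_supersets_avoiding q r (F : {ffun 'I_(q + 1) -> 'I_m} -> R) :
    (r <= m)%N ->
  (forall f : {ffun 'I_(q + 1) -> 'I_m}, ~~ injectiveb f -> F f = 0) ->
  \sum_(I in qsubsets r m) \sum_(i | i \notin I)
    \sum_(f : {ffun 'I_q -> 'I_m} | f @: setT \subset I) F (ffun_snoc f i)
  = ('C(m - q, m - r)%:R - 'C(m - (q + 1), m - r)%:R) * \sum_f F f.
Proof.
move=> rm F0; rewrite sum_ffun_snoc.
under eq_bigr => I _ do [rewrite big_mkcond /=;
  under eq_bigr => i _ do [rewrite big_mkcond /=]].
transitivity (\sum_(I in qsubsets r m) \sum_i \sum_(f : {ffun 'I_q -> 'I_m})
    if (f @: setT \subset I) && (i \notin I) then F (ffun_snoc f i) else 0).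
  apply: eq_bigr => I _; apply: eq_bigr => i _; case: (i \notin I).
    by apply: eq_bigr => f _; rewrite andbT.
  by rewrite big1 // => f _; rewrite andbF.
rewrite exchange_big /= big_distrr /=.
under eq_bigr => i _ do rewrite exchange_big /=.
rewrite exchange_big /=; apply: eq_bigr => f _.
rewrite big_distrr /=; apply: eq_bigr => i _.
have [fN|] := boolP (~~ injectiveb (ffun_snoc f i)).
  by rewrite F0 // mulr0 big1 // => I _; rewrite if_same.
rewrite negbK => /injectiveP fiI.
have fI : injective f.
  apply/injectiveP/negPn/negP => /(ffun_snoc_noninj i)/negP; apply.
  exact/injectiveP.
have iS : i \notin f @: setT.
  apply/negP => /imsetP[a _ ia].
  have : ffun_snoc f i (rshift q 0) = ffun_snoc f i (lshift 1 a).
    by rewrite ffun_snoc_r ffun_snoc_l.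
  by move=> /fiI/eqP; rewrite eq_rlshift.
rewrite -big_mkcondr /= sumr_const -[LHS]mulr_natl; congr (_ * _).
have cf : #|f @: setT| = q by rewrite card_imset // cardsT card_ord.
rewrite addn1 -[in RHS]cf -(card_supersets_avoiding _ rm iS); congr (_ %:R).
by apply: eq_card => I; rewrite unfold_in !inE.
Qed.

Definition sum_sqminors q : R :=
  \sum_(g : {ffun 'I_q -> 'I_n}) \sum_(f : {ffun 'I_q -> 'I_m}) sqminor f g.

Lemma sum_sqminors_principal q :
  sum_sqminors q =
  q`!%:R ^+ 2 * \sum_(S in qsubsets q n) \det (principal_mx S (M^T *m M)).
Proof.
rewrite expr2 -mulrA -sum_det_mxsub_principal big_distrr /=.
apply: eq_bigr => g _.
have -> : mxsub g g (M^T *m M) = (colsub g M)^T *m colsub g M.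
  by apply/matrixP=> a b; rewrite !mxE; apply: eq_bigr => l _; rewrite !mxE.
rewrite det_gram; apply: eq_bigr => h _; rewrite /sqminor.
by congr (\det _ ^+ 2); apply/matrixP=> a b; rewrite !mxE.
Qed.

Lemma vs_zetaE k r : (r <= m)%N ->
  k`!%:R ^+ 2 * vs_zeta r k M = 'C(m - k, m - r)%:R * sum_sqminors k.
Proof.
move=> rm; rewrite /vs_zeta expr2 -mulrA.
have volX I : k`!%:R * \sum_(J in qsubsets k n) vol2 M I J =
    \sum_(g : {ffun 'I_k -> 'I_n}) volume_sum I g.
  rewrite (sum_qsubsets k (X := fun q g => volume_sum I g)) => [|q g s|q g gN].
  - by congr (_ * _); apply: eq_bigr => J _; rewrite vol2_sqminor.
  - by congr (_ * _); apply: eq_bigr => f _; rewrite sqminor_perm.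
  - by rewrite /volume_sum big1 ?mulr0 // => f _; rewrite sqminor_noninj_r.
rewrite [k`!%:R * \sum_(I in _) _]big_distrr /=.
under eq_bigr => I _ do rewrite volX /volume_sum -big_distrr /=.
rewrite -big_distrr mulVKf ?fact_neq0 // exchange_big big_distrr /=.
apply: eq_bigr => g _; rewrite sum_supersets // => f fN.
exact: sqminor_noninj_l.
Qed.

Lemma sum_error_bounds k r : (r <= m)%N ->
  k`!%:R ^+ 2 * (\sum_(I in qsubsets r m) \sum_(J in qsubsets k n)
     (inner_error I (enum_ffun J) + outer_error I (enum_ffun J))) =
  ('C(m - (k + 1), m - r)%:R / (k + 1)%:R
    + ('C(m - k, m - r)%:R - 'C(m - (k + 1), m - r)%:R))
  * sum_sqminors (k + 1).
Proof.
move=> rm; rewrite expr2 -mulrA.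
have errX I : k`!%:R * \sum_(J in qsubsets k n)
      (inner_error I (enum_ffun J) + outer_error I (enum_ffun J)) =
    \sum_(g : {ffun 'I_k -> 'I_n}) (inner_error I g + outer_error I g).
  rewrite (sum_qsubsets k (X := fun q g => inner_error I g + outer_error I g))
    => [//|q g s|q g gN].
  - congr (_ * _ + _ * _); apply: eq_bigr => j _.
      by apply: eq_bigr => f _; rewrite sqminor_snoc_perm.
    apply: eq_bigr => i _.
    by apply: eq_bigr => f _; rewrite sqminor_snoc_perm.
  - rewrite /inner_error /outer_error big1 ?mulr0 ?add0r ?big1 ?mulr0 // => j _.
      by rewrite big1 // => i _; rewrite big1 // => f _;
        rewrite sqminor_noninj_r // ffun_snoc_noninj.
    by rewrite big1 // => f _; rewrite sqminor_noninj_r // ffun_snoc_noninj.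
rewrite [k`!%:R * \sum_(I in _) _]big_distrr /=.
under eq_bigr => I _ do rewrite errX big_split /= -!big_distrr /=.
rewrite big_split /= -!big_distrr /= mulrDr mulrDl; congr (_ + _).
  have -> : (k + 1)`!%:R = (k + 1)%:R * k`!%:R :> R.
    by rewrite addn1 factS natrM.
  set S := \sum_(I in _) _.
  suff -> : S = 'C(m - (k + 1), m - r)%:R * sum_sqminors (k + 1).
    by field; rewrite fact_neq0 natr1 pnatr_eq0.
  rewrite /S /sum_sqminors sum_ffun_snoc exchange_big big_distrr /=.
  apply: eq_bigr => g _; rewrite exchange_big big_distrr /=.
  apply: eq_bigr => j _; rewrite sum_supersets // => f fN.
  exact: sqminor_noninj_l.
rewrite mulVKf ?fact_neq0 // /sum_sqminors sum_ffun_snoc exchange_big big_distrr /=.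
apply: eq_bigr => g _; rewrite exchange_big big_distrr /=.
apply: eq_bigr => j _; rewrite -sum_supersets_avoiding // => f fN.
exact: sqminor_noninj_l.
Qed.

End SquaredMinors.
(** * The expected error *)

Theorem corollary1 (R : realType) (m n k r : nat) (M : 'M[R]_(m, n))
    (sigma : 'I_n -> R)
    (hmn : (n <= m)%N) (hk1 : (1 <= k)%N) (hkr : (k <= r)%N) (hrm : (r <= m)%N)
    (hkn : (k <= n)%N) (hkm : (k < m)%N) (hrank : (k <= \rank M)%N)
    (hsigma : singular_values M sigma) :
  vs_expectation r k M (fun I J => frobenius_norm (M - CUR M I J) ^+ 2)
  <= ((m%:R - r%:R) / (m%:R - k%:R) * (k%:R + 1) ^+ 2
      + (r%:R - k%:R) / (m%:R - k%:R) * (k%:R + 1))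
     * \sum_(i < n | (k <= i)%N) sigma i ^+ 2.
Proof.
case: hsigma => _ _ charM; set tail := \sum_(i < n | _) _; set coef := (X in X * _).
have mk0 : 0 < m%:R - k%:R :> R by rewrite subr_gt0 ltr_nat.
have tail0 : 0 <= tail by apply: sumr_ge0 => i _; exact: sqr_ge0.
have coef0 : 0 <= coef.
  have mr0 : 0 <= m%:R - r%:R :> R by rewrite subr_ge0 ler_nat.
  have rk0 : 0 <= r%:R - k%:R :> R by rewrite subr_ge0 ler_nat.
  have k10 : 0 <= k%:R + 1 :> R by rewrite natr1.
  by rewrite addr_ge0 // mulr_ge0 ?exprn_ge0 // divr_ge0 // ltW.
pose e q := \sum_(S in qsubsets q n) \prod_(i in S) sigma i ^+ 2.
have minors_e q : sum_sqminors M q = q`!%:R ^+ 2 * e q.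
  rewrite sum_sqminors_principal; congr (_ * _).
  rewrite (@eq_char_poly_principal _ _ _ (diag_mx (\row_i sigma i ^+ 2))).
    by apply: eq_bigr => S _; rewrite det_principal_diag.
  rewrite charM char_poly_trig; last exact: diag_mx_is_trig.
  by apply: eq_bigr => i _; rewrite !mxE eqxx.
have e_le : e (k + 1)%N <= tail * e k.
  by rewrite addn1; apply: esym_tail_le => i; exact: sqr_ge0.
set N : R := 'C(m - k, m - r)%:R; set N' : R := 'C(m - (k + 1), m - r)%:R.
have N'E : N' = (r%:R - k%:R) / (m%:R - k%:R) * N.
  apply: (mulfI (lt0r_neq0 mk0)); rewrite mulrA mulrCA mulfV ?lt0r_neq0 // mulr1.
  rewrite -!natrB //; last exact: ltnW.
  rewrite /N /N' -!natrM; congr (_ %:R); rewrite addn1 subnS mul_bin_down.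
  by congr (_ * _)%N; lia.
have zetaE : vs_zeta r k M = N * e k.
  apply: (mulfI (expf_neq0 2 (fact_neq0 R k))).
  by rewrite vs_zetaE // minors_e mulrCA.
have zeta0 : 0 <= vs_zeta r k M.
  by apply: sumr_ge0 => I _; apply: sumr_ge0 => J _; exact: vol2_ge0.
have total : \sum_(I in qsubsets r m) \sum_(J in qsubsets k n)
    vol2 M I J * frobenius_norm (M - CUR M I J) ^+ 2
    <= coef * tail * vs_zeta r k M.
  apply: (@le_trans _ _ (coef * N * e (k + 1)%N)); last first.
    rewrite zetaE -!mulrA ler_wpM2l // mulrCA ler_wpM2l ?ler0n //.
  apply: le_trans (ler_sum _ (fun I _ =>
    ler_sum _ (fun J _ => vol2_error_le M I J))) _.
  rewrite -(ler_pM2l (x := k`!%:R ^+ 2)) ?exprn_gt0 ?ltr0n ?fact_gt0 //.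
  rewrite sum_error_bounds // minors_e -/N -/N' le_eqVlt.
  apply/orP; left; apply/eqP.
  rewrite N'E addn1 factS natrM /coef -natr1.
  have k10 : k%:R + 1 != 0 :> R by rewrite natr1 pnatr_eq0.
  by field; rewrite (lt0r_neq0 mk0) k10.
have -> : vs_expectation r k M (fun I J => frobenius_norm (M - CUR M I J) ^+ 2) =
    (vs_zeta r k M)^-1 * \sum_(I in qsubsets r m) \sum_(J in qsubsets k n)
      vol2 M I J * frobenius_norm (M - CUR M I J) ^+ 2.
  rewrite big_distrr /=; apply: eq_bigr => I _; rewrite big_distrr /=.
  by apply: eq_bigr => J _; rewrite /vs_prob -mulrA.
(* For zeta = 0 the inverse, hence the expectation, is 0. *)
move: zeta0; rewrite le_eqVlt => /predU1P[<-|zeta_gt0].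
  by rewrite invr0 mul0r mulr_ge0.
by rewrite mulrC ler_pdivrMr.
Qed.
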